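(* Let $p$ be a prime and let $i\geq 0$. If $p$ is odd, then $O(c_i)=N_0\cdots N_i$ if and only if $M_j=N_j$ for all $0\leq j\leq i$. If $p=2$ and $i\geq 5$, then $O(c_i)=N_1\cdots N_i$ if and only if $M_j=N_j$ for all $5\leq j\leq i$.
   Context: Fix a prime $p$ and an algebraic closure $E$ of $\mathbb{F}_p$. Put $c_{-1}=1$ and, recursively for $i\geq -1$, let $c_{i+1}\in E$ be any chosen root of $X^p-X-(c_{-1}c_0\cdots c_i)^{p-1}$. Put $L_{-1}=\mathbb{F}_p$ and $L_{i+1}=L_i[c_{i+1}]$ for $i\geq -1$. All $c_i$ are nonzero. For $i\geq 0$ put $N_i=\dfrac{p^{p^{i+1}}-1}{p^{p^i}-1}$, and let $M_i$ be the order of $c_i$ modulo $L_{i-1}^\times$, i.e. the smallest $n\geq 1$ with $c_i^n\in L_{i-1}^\times$. For $x\in E^\times$, $O(x)$ denotes the multiplicative order of $x$. *)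

(* Defs.v *)
From mathcomp Require Import all_boot all_order all_algebra.
From mathcomp Require Import boolp.

Set Implicit Arguments.
Unset Strict Implicit.
Unset Printing Implicit Defensive.

Import GRing.Theory.
Local Open Scope ring_scope.

Definition is_algebraic_closure (F : fieldType) (E : closedFieldType)
    (iota : {rmorphism F -> E}) : Prop :=
  forall x : E, algebraicOver iota x.

(* For i = 0 the product is empty: it stands for c_{-1} = 1.  In general
   \prod_(j < i) c j is c_{-1} c_0 ... c_{i-1}. *)
Definition is_tower_sequence (E : fieldType) (p : nat) (c : nat -> E) : Prop :=
  forall i : nat,
    root ('X^p - 'X - ((\prod_(j < i) c j) ^+ p.-1)%:P) (c i).

Definition adjoin_ring (E : fieldType) (K : {pred E}) (x : E) : {pred E} :=
  fun y => `[< exists2 q : {poly E}, q \is a polyOver K & y = q.[x] >].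

(* Indices are shifted by one: tower iota c i is L_{i-1}. *)
Fixpoint tower (F : finFieldType) (E : fieldType) (iota : {rmorphism F -> E})
    (c : nat -> E) (i : nat) : {pred E} :=
  if i is i'.+1 then adjoin_ring (tower iota c i') (c i')
  else [pred y | y \in codom iota].

(* The least n >= 1 with x ^+ n in H, and 0 if there is no such n. *)
Definition order_mod (E : fieldType) (H : {pred E}) (x : E) : nat :=
  match pselect (exists n : nat, (0 < n)%N && (x ^+ n \in H)) with
  | left exn => ex_minn exn
  | right _ => 0%N
  end.

Definition mul_order (E : fieldType) (x : E) : nat :=
  order_mod (pred1 (1 : E)) x.

Definition N_ (p i : nat) : nat :=
  ((p ^ (p ^ i.+1) - 1) %/ (p ^ (p ^ i) - 1))%N.

Definition M_ (F : finFieldType) (E : fieldType) (iota : {rmorphism F -> E})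
    (c : nat -> E) (i : nat) : nat :=
  order_mod [pred y in tower iota c i | y != 0] (c i).

(* Main.v *)
(* Let q_k = p^(p^k) and P_k = c_{-1} c_0 ... c_{k-1}.  By induction on k,
   c_k^(q_k) = c_k + t_k with t_k a nonzero element of the prime field, so
   L_{k-1} consists of roots of X^(q_k) - X, the conjugates of c_k are the
   c_k + m t_k, and taking their product (a norm) gives c_k^(N_k) = P_k^(p-1)
   and P_{k+1}^(N_k) = P_k^(2p-1).  The elements c_k and P_{k+1} both have
   order M_k modulo L_{k-1}^*.  Put s = 0 for p odd and s = 1 for p = 2.  As
   N_s ... N_{k-1} = (q_k - 1)/(q_s - 1) is prime to p - 1 and 2p - 1 and N_k is
   prime to q_k - 1, descending along these identities shows that N_s ... N_k
   divides O(c_k) if and only if M_j = N_j for s <= j <= k; conversely O(c_k)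
   always divides N_s ... N_k (for k >= 2 if p = 2).  For p = 2, the Fermat
   numbers N_1, ..., N_4 are primes, which forces M_j = N_j for j < 5. *)

Require Import Defs.
From HB Require Import structures.
From mathcomp Require Import all_boot all_order all_algebra all_field.
From mathcomp Require Import boolp.

Set Implicit Arguments.
Unset Strict Implicit.
Unset Printing Implicit Defensive.

Import GRing.Theory.
Local Open Scope ring_scope.

(** * Orders of elements, absolute and modulo a subgroup *)

Lemma dvdn_order_mod (E : fieldType) (H : {pred E}) (x : E) (n : nat) :
  divr_closed H -> x != 0 -> (order_mod H x %| n)%N = (x ^+ n \in H).
Proof.
move=> [H1 Hdiv] x0; have Hmul : {in H &, forall u v, u * v \in H}.
  move=> u v Hu Hv; rewrite -[v]invrK; apply: (Hdiv) => //.
  by rewrite -[v^-1]mul1r; apply: Hdiv.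
rewrite /order_mod; case: pselect => [ex_n | no_n]; last first.
  (* The default value 0 is consistent: 0 divides only 0, and only the trivial power then lies in
     [H]. *)
  rewrite dvd0n; apply/eqP/idP => [-> | Hn]; first by rewrite expr0.
  by case: n Hn => // n Hn; case: no_n; exists n.+1.
case: ex_minnP => m /andP[m_gt0 Hm] m_min.
have Hmk k : x ^+ (k * m)%N \in H.
  elim: k => [|k IHk]; first by rewrite mul0n expr0.
  by rewrite mulSn exprD Hmul.
apply/idP/idP => [/dvdnP[k ->] // | Hn].
have Hr : x ^+ (n %% m)%N \in H.
  have -> : x ^+ (n %% m)%N = x ^+ n / x ^+ (n %/ m * m)%N.
    rewrite {2}(divn_eq n m) exprD [_ ^+ (n %/ m * m)%N * _]mulrC mulfK //.
    exact: expf_neq0.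
  exact: Hdiv.
rewrite /dvdn -leqn0 leqNgt; apply/negP => r_gt0.
have := m_min (n %% m)%N; rewrite r_gt0 Hr leqNgt ltn_mod m_gt0.
by move/(_ isT).
Qed.

Lemma dvdn_mul_order (E : fieldType) (x : E) (n : nat) :
  x != 0 -> (mul_order x %| n)%N = (x ^+ n == 1).
Proof.
move=> x0; rewrite /mul_order dvdn_order_mod //.
by split=> [|u v]; rewrite ?inE // => /eqP-> /eqP->; rewrite divr1.
Qed.

Lemma mul_order_dvdX (E : fieldType) (x : E) (e : nat) :
  x != 0 -> (mul_order x %| e * mul_order (x ^+ e))%N.
Proof.
by move=> x0; rewrite dvdn_mul_order // exprM -dvdn_mul_order ?expf_neq0.
Qed.

Lemma mul_orderX_dvd (E : fieldType) (x : E) (e : nat) :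
  x != 0 -> (mul_order (x ^+ e) %| mul_order x)%N.
Proof.
move=> x0; rewrite dvdn_mul_order ?expf_neq0 // -exprM mulnC exprM.
have := dvdnn (mul_order x); rewrite dvdn_mul_order // => /eqP->.
by rewrite expr1n.
Qed.

Lemma dvdn_mul_orderX (E : fieldType) (x : E) (d e : nat) :
  x != 0 -> coprime d e -> (d %| mul_order x)%N -> (d %| mul_order (x ^+ e))%N.
Proof.
move=> x0 co_de dO; rewrite -(Gauss_dvdr _ co_de).
exact: dvdn_trans dO (mul_order_dvdX _ x0).
Qed.

(** Logarithmic derivative; it turns the factorization of X^p - X into a sum over the shifts of
    x. *)
Lemma horner_deriv_prod (F : fieldType) (I : Type) (s : seq I)
    (f : I -> {poly F}) (x : F) : (forall i, (f i).[x] != 0) ->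
  (\prod_(i <- s) f i)^`().[x] =
    (\prod_(i <- s) f i).[x] * \sum_(i <- s) (f i)^`().[x] / (f i).[x].
Proof.
move=> f0; elim: s => [|i s IHs].
  by rewrite !big_nil derivC hornerC mulr0.
rewrite !big_cons derivM hornerD !hornerM IHs mulrDr !mulrA; congr (_ + _).
apply: (mulIf (f0 i)); rewrite mulfVK //.
by rewrite mulrC [_ * (\prod_(j <- s) _).[x]]mulrC mulrA.
Qed.

(** * Frobenius powers and sums and products over shifts by the prime field *)

Section Characteristic.

Variables (E : fieldType) (p : nat).
Hypothesis charE : p \in [pchar E].

Let p_prime : prime p. Proof. exact: pcharf_prime charE. Qed.
Let p_gt0 : (0 < p)%N. Proof. exact: prime_gt0. Qed.

Lemma frobD m (x y : E) : (x + y) ^+ (p ^ m) = x ^+ (p ^ m) + y ^+ (p ^ m).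
Proof. by apply: exprDn_pchar; rewrite pnatX pnatE // charE. Qed.

Lemma frob0 m : (0 : E) ^+ (p ^ m) = 0.
Proof. by rewrite expr0n expn_eq0 (gtn_eqF p_gt0). Qed.

Lemma frobN m (x : E) : (- x) ^+ (p ^ m) = - x ^+ (p ^ m).
Proof.
by apply/eqP; rewrite -addr_eq0 -frobD addNr frob0.
Qed.

Lemma frobMn m n (x : E) : (x *+ n) ^+ (p ^ m) = x ^+ (p ^ m) *+ n.
Proof.
elim: n => [|n IHn]; last by rewrite !mulrS frobD IHn.
by rewrite !mulr0n frob0.
Qed.

Lemma frob_sum m (I : finType) (F : I -> E) :
  (\sum_i F i) ^+ (p ^ m) = \sum_i F i ^+ (p ^ m).
Proof. exact: (big_morph (fun x => x ^+ (p ^ m)) (frobD m) (frob0 m)). Qed.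

Lemma frob_fixX m n (x : E) : x ^+ m = x -> x ^+ (m ^ n) = x.
Proof. by move=> xm; elim: n => [|n IHn] //; rewrite expnS exprM xm. Qed.

Lemma frob_shift m n (x t : E) :
    t ^+ (p ^ m) = t -> x ^+ (p ^ m) = x + t ->
  x ^+ ((p ^ m) ^ n) = x + t *+ n.
Proof.
move=> tm xm; elim: n => [|n IHn]; first by rewrite mulr0n addr0.
by rewrite expnSr exprM IHn frobD frobMn tm xm mulrS addrA.
Qed.

(** The multiples of t are p distinct roots of a monic polynomial of degree p. *)
Lemma prod_XaddFp (t : E) : t != 0 -> t ^+ p = t ->
  \prod_(i < p) ('X + (t *+ i)%:P) = 'X^p - 'X.
Proof.
move=> t0 tp.
have sz : size ('X^p - 'X : {poly E}) = p.+1.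
  by rewrite size_polyDl size_polyXn // size_polyN size_polyX ltnS prime_gt1.
have lc : lead_coef ('X^p - 'X : {poly E}) = 1.
  rewrite lead_coefDl ?lead_coefXn // size_polyN size_polyX size_polyXn ltnS.
  exact: prime_gt1.
pose rs := [seq - (t *+ i) | i <- iota 0 p].
rewrite (@all_roots_prod_XsubC _ ('X^p - 'X) rs).
- rewrite lc scale1r /rs big_map.
  rewrite -(big_mkord xpredT (fun i => 'X + (t *+ i)%:P)) /index_iota subn0.
  by apply: eq_bigr => i _; rewrite polyCN opprK.
- by rewrite sz size_map size_iota.
- apply/allP => _ /mapP[i _ ->]; rewrite rootE !hornerE.
  have := frobN 1 (t *+ i); have := frobMn 1 i t; rewrite expn1 tp => -> ->.
  by rewrite subrr.
rewrite uniq_rootsE map_inj_in_uniq ?iota_uniq // => i j.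
have wlog_ij a b : (a <= b)%N -> (b < p)%N -> t *+ a = t *+ b -> a = b.
  move=> le_ab lt_bp eq_ab.
  have: t *+ (b - a) = 0 by rewrite mulrnBr // eq_ab subrr.
  move/eqP; rewrite -mulr_natr mulf_eq0 (negPf t0) /= -(dvdn_pcharf charE).
  have [ba0 _ | ba_gt0 /(dvdn_leq ba_gt0)] := posnP (b - a).
    by apply/eqP; rewrite eqn_leq le_ab -subn_eq0 ba0.
  by rewrite leqNgt (leq_ltn_trans (leq_subr _ _) lt_bp).
rewrite !mem_iota !add0n => /= lt_i lt_j /oppr_inj eq_ij.
by case/orP: (leq_total i j) => le; [|symmetry]; apply: wlog_ij.
Qed.

Lemma prod_addFp (x t : E) : t != 0 -> t ^+ p = t ->
  \prod_(i < p) (x + t *+ i) = x ^+ p - x.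
Proof.
move=> t0 tp; have /(congr1 (fun f => f.[x])) := prod_XaddFp t0 tp.
rewrite horner_prod !hornerE => <-.
by apply: eq_bigr => i _; rewrite !hornerE.
Qed.

(* The logarithmic derivative of [prod_XaddFp] at x is the sum of the 1/y for
   y = x + i t, and y^(p-1) = 1 + (x^p - x)/y. *)
Lemma sum_addFp_exp (x t : E) : t != 0 -> t ^+ p = t -> x ^+ p != x ->
  \sum_(i < p) (x + t *+ i) ^+ p.-1 = -1.
Proof.
move=> t0 tp xp.
have yp (i : 'I_p) : (x + t *+ i) ^+ p - (x + t *+ i) = x ^+ p - x.
  have := frobD 1 x (t *+ i); rewrite expn1 => ->.
  have := frobMn 1 i t; rewrite expn1 tp => ->.
  by rewrite opprD addrACA subrr addr0.
have y0 (i : 'I_p) : x + t *+ i != 0.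
  apply: contra_neq xp => y0; have := yp i; rewrite y0 expr0n gtn_eqF // subrr.
  by move/esym/eqP; rewrite subr_eq0 => /eqP.
have := congr1 (fun f => (deriv f).[x]) (prod_XaddFp t0 tp).
rewrite derivB derivXn derivX -mulr_natr -polyC_natr (pcharf0 charE) mulr0.
rewrite sub0r hornerN hornerC horner_deriv_prod; last first.
  by move=> i; rewrite !hornerE.
rewrite prod_XaddFp // !hornerE => <-; rewrite mulr_sumr.
transitivity (\sum_(i < p) ((x + t *+ i) ^+ p.-1 - 1)).
  by rewrite sumrB sumr_const card_ord (pcharf0 charE) subr0.
apply: eq_bigr => i _.
rewrite derivD derivX derivC !hornerE /= mulr1 -(yp i).
by apply: (mulIf (y0 i)); rewrite mulfVK // mulrBl mul1r -exprSr prednK.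
Qed.

End Characteristic.

Lemma adjoin_ring_subring (E : fieldType) (K : {pred E}) (x : E) :
    subring_closed K ->
  [/\ subring_closed (adjoin_ring K x), {subset K <= adjoin_ring K x}
     & x \in adjoin_ring K x].
Proof.
(* Packing [K] as a subring makes the closure properties of [polyOver] available. *)
move=> K_sub; pose Kr := GRing.isSubringClosed.Build E K K_sub.
pose S : subringClosed E := HB.pack K Kr.
have memP y : reflect (exists2 q, q \is a polyOver S & y = q.[x])
    (y \in adjoin_ring K x).
  exact: asboolP.
split; first split.
- by apply/memP; exists 1; rewrite ?rpred1 ?hornerC.
- move=> _ _ /memP[q Sq ->] /memP[r Sr ->].
  by apply/memP; exists (q - r); rewrite ?rpredB ?hornerD ?hornerN.
- move=> _ _ /memP[q Sq ->] /memP[r Sr ->].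
  by apply/memP; exists (q * r); rewrite ?rpredM ?hornerM.
- by move=> y Ky; apply/memP; exists y%:P; rewrite ?polyOverC ?hornerC.
by apply/memP; exists 'X; rewrite ?polyOverX ?hornerX.
Qed.

(** * Arithmetic of the numbers N_k *)

Section Numbers.

Variable p : nat.
Hypothesis p_prime : prime p.

Let p_gt1 : (1 < p)%N. Proof. exact: prime_gt1. Qed.
Let p_gt0 : (0 < p)%N. Proof. exact: prime_gt0. Qed.

Lemma card_towerS k : (p ^ (p ^ k.+1) = (p ^ (p ^ k)) ^ p)%N.
Proof. by rewrite expnSr expnM. Qed.

Lemma card_tower_gt1 k : (1 < p ^ (p ^ k))%N.
Proof. by rewrite -[X in (X < _)%N](expn0 p) ltn_exp2l ?expn_gt0 ?p_gt0. Qed.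

(** Geometric series of ratio q_k; this is the exponent of the norm from the field of q_k^p elements
    to that of q_k elements. *)
Lemma N_sum k : N_ p k = (\sum_(i < p) (p ^ (p ^ k)) ^ i)%N.
Proof.
rewrite /N_ !subn1 card_towerS predn_exp mulKn //.
by rewrite -subn1 subn_gt0 card_tower_gt1.
Qed.

Lemma N_mul k : (N_ p k * (p ^ (p ^ k) - 1) = p ^ (p ^ k.+1) - 1)%N.
Proof. by rewrite N_sum card_towerS !subn1 mulnC -predn_exp. Qed.

Lemma N_gt0 k : (0 < N_ p k)%N.
Proof.
have : (0 < N_ p k * (p ^ (p ^ k) - 1))%N.
  by rewrite N_mul subn_gt0 card_tower_gt1.
by rewrite muln_gt0 => /andP[].
Qed.

Lemma prod_N_mul s k : (s <= k)%N ->
  ((\prod_(s <= j < k) N_ p j) * (p ^ (p ^ s) - 1) = p ^ (p ^ k) - 1)%N.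
Proof.
elim: k => [|k IHk]; first by rewrite leqn0 => /eqP->; rewrite big_geq ?mul1n.
rewrite leq_eqVlt => /orP[/eqP<- | le_sk]; first by rewrite big_geq ?mul1n.
by rewrite big_nat_recr //= mulnAC IHk // mulnC N_mul.
Qed.

(** Modulo q_k - 1 each of the p terms of the geometric series is 1, so N_k is congruent to p, and p
    is prime to q_k - 1. *)
Lemma coprime_N_card k : coprime (N_ p k) (p ^ (p ^ k) - 1).
Proof.
rewrite N_sum coprime_sym; set q1 := (_ - 1)%N.
have Eq : (p ^ p ^ k = q1 + 1)%N by rewrite subnK // expn_gt0 p_gt0.
have Emod : (\sum_(i < p) (p ^ p ^ k) ^ i = p %[mod q1])%N.
  rewrite -modn_summ; under eq_bigr do rewrite Eq -modnXm modnDl modnXm exp1n.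
  by rewrite modn_summ sum1_card card_ord.
rewrite -coprime_modr Emod coprime_modr.
by rewrite -(@coprime_pexpr (p ^ k)) ?expn_gt0 ?p_gt0 // Eq addn1 coprimenS.
Qed.

(* A prime r dividing both numbers, for which p has p-power order modulo r, is
   either a divisor of p - 1, hence of 2p - 1 - 2(p - 1) = 1, or 1 modulo p,
   hence equal to p + 1, which is even. *)
Lemma coprime_card_2p1 k : odd p -> coprime (p ^ (p ^ k) - 1) (p + p.-1).
Proof.
move=> p_odd; rewrite /coprime; set g := gcdn _ _; apply: contraT => g_neq1.
have g_gt1 : (1 < g)%N.
  by rewrite ltn_neqAle eq_sym g_neq1 gcdn_gt0 addn_gt0 p_gt0 orbT.
pose r := pdiv g; have r_prime : prime r := pdiv_prime g_gt1.
have r_dvd1 : (r %| p ^ (p ^ k) - 1)%N.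
  exact: dvdn_trans (pdiv_dvd g) (dvdn_gcdl _ _).
have r_dvd2 : (r %| p + p.-1)%N := dvdn_trans (pdiv_dvd g) (dvdn_gcdr _ _).
pose x : 'F_r := p%:R.
have x1 n : (r %| p ^ n - 1)%N = (x ^+ n == 1).
  rewrite (dvdn_pcharf (pchar_Fp r_prime)) natrB ?expn_gt0 ?p_gt0 //.
  by rewrite natrX subr_eq0.
have x0 : x != 0.
  apply: contraL r_dvd1 => /eqP x0; rewrite x1 x0 expr0n expn_eq0.
  by rewrite gtn_eqF // eq_sym oner_eq0.
have o_dvdr : (mul_order x %| r.-1)%N.
  rewrite dvdn_mul_order // -(inj_eq (mulfI x0)) mulr1 -exprS.
  rewrite prednK ?prime_gt0 //.
  by have := expf_card x; rewrite card_Fp // => ->.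
have o_dvdp : (mul_order x %| p ^ k)%N by rewrite dvdn_mul_order // -x1.
have [p_dvd | p_ndvd] := boolP (p %| r.-1)%N; last first.
  have : (mul_order x %| 1)%N.
    have /eqP <- : coprime (p ^ k) r.-1 by rewrite coprimeXl // prime_coprime.
    by rewrite dvdn_gcd o_dvdp.
  rewrite dvdn_mul_order // -x1 expn1 subn1 => r_dvd3.
  have : (r %| 1)%N.
    rewrite -(dvdn_addr 1 r_dvd3) addn1 prednK //.
    by rewrite -(dvdn_addl _ r_dvd3).
  by rewrite dvdn1 => /eqP r1; rewrite r1 in r_prime.
have [m Er] := dvdnP p_dvd.
have r_le : (r <= p + p.-1)%N by apply: dvdn_leq; rewrite ?addn_gt0 ?p_gt0.
have r_gt1 := prime_gt1 r_prime.
have Er1 : r = (m * p).+1 by rewrite -Er prednK // ltnW.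
have m1 : m = 1%N.
  have : (m < 2)%N.
    rewrite -(ltn_pmul2r p_gt0) -Er1 mul2n -addnn.
    by apply: leq_trans r_le _; rewrite leq_add2l leq_pred.
  by case: m Er1 {Er} => [|[|m]] // Er1 _; rewrite Er1 in r_gt1.
have : odd r by apply: dvdn_odd r_dvd2 _; rewrite oddD -subn1 oddB // p_odd.
by rewrite Er1 m1 mul1n /= p_odd.
Qed.

End Numbers.

(** * Conjugates, norms and orders in the tower *)

Section Tower.

Variables (p : nat) (E : fieldType) (iota : {rmorphism 'F_p -> E}).
Variable c : nat -> E.
Hypotheses (p_prime : prime p) (c_tower : is_tower_sequence p c).

Let charE : p \in [pchar E]. Proof. exact/(rmorph_pchar iota)/pchar_Fp. Qed.
Let p_gt0 : (0 < p)%N. Proof. exact: prime_gt0. Qed.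

Local Notation q k := (p ^ (p ^ k))%N.
Local Notation P k := (\prod_(j < k) c j).
Local Notation Pi s k := (\prod_(s <= j < k) N_ p j)%N.
Local Notation H k := [pred y in tower iota c k | y != 0].

Lemma tower_eq k : c k ^+ p - c k = P k ^+ p.-1.
Proof. by have := c_tower k; rewrite rootE !hornerE subr_eq0 => /eqP. Qed.

Lemma tower_neq0 k : c k != 0.
Proof.
elim/ltn_ind: k => k IHk; apply/eqP => ck0.
have := tower_eq k; rewrite ck0 expr0n gtn_eqF // subr0 => /esym/eqP.
by apply/negP/expf_neq0/prodf_neq0 => j _; apply: IHk.
Qed.

Lemma tower_prod_neq0 k : P k != 0.
Proof. by apply/prodf_neq0 => j _; apply: tower_neq0. Qed.

(* With B the sum of the c_{k+1}^(q_k^m), 0 <= m < p, one finds B^p - B =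
   - a_k for a_k = c_k^p - c_k, so -B is c_k plus an element of the prime field
   and the shift of c_{k+1} under the q_{k+1}-Frobenius is minus that of c_k
   under the q_k-Frobenius. *)
Lemma tower_conj k : (forall j, (j < k)%N -> c j ^+ q k = c j) /\
  exists t, [/\ t != 0, t ^+ p = t & c k ^+ q k = c k + t].
Proof.
elim: k => [|k [fix_k [t [t0 tp conj_k]]]].
  split=> //; exists 1; rewrite oner_eq0 expr1n expn0 expn1; split=> //.
  by have /eqP := tower_eq 0; rewrite big_ord0 expr1n subr_eq addrC => /eqP.
have tq m : t ^+ (p ^ m) = t := frob_fixX m tp.
have conj_m m : c k ^+ (q k ^ m) = c k + t *+ m.
  exact: (frob_shift charE).
have P_fix : P k ^+ q k = P k.
  by rewrite -prodrXl; apply: eq_bigr => j _; apply: fix_k.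
split.
  move=> j; rewrite ltnS leq_eqVlt card_towerS => /orP[/eqP-> | lt_jk].
    by rewrite conj_m -mulr_natr (pcharf0 charE) mulr0 addr0.
  by apply: frob_fixX; apply: fix_k.
exists (- t); rewrite oppr_eq0; split=> //.
  by have := frobN charE 1 t; rewrite expn1 tp.
set b := c k.+1; have b_eq : b ^+ p = b + (P k * c k) ^+ p.-1.
  by have /eqP := tower_eq k.+1; rewrite big_ord_recr /= subr_eq addrC => /eqP.
have qX m : (q k ^ m = p ^ (p ^ k * m))%N by rewrite expnM.
pose B := \sum_(m < p) b ^+ (q k ^ m).
(* Raising the equation of b to the power q_k^m gives the m-th term P_k^(p-1) (c_k + m t)^(p-1);
   [sum_addFp_exp] sums these. *)
have Bp : B ^+ p - B = - P k ^+ p.-1.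
  have := frob_sum charE 1 (fun m : 'I_p => b ^+ (q k ^ m)).
  rewrite expn1 => ->; rewrite -sumrB -[RHS]mulrN1.
  have ck_p : c k ^+ p != c k.
    by rewrite -subr_eq0 tower_eq expf_neq0 ?tower_prod_neq0.
  rewrite -(sum_addFp_exp charE t0 tp ck_p) mulr_sumr; apply: eq_bigr => m _.
  rewrite exprAC b_eq qX (frobD charE) addrC addKr -qX.
  by rewrite exprAC exprMn conj_m frob_fixX // exprMn.
(* The q_k-Frobenius shifts the sum by one index: b leaves and its power of exponent q_k^p = q_{k+1}
   enters. *)
have Bq : B ^+ q k = B - b + b ^+ q k.+1.
  rewrite (frob_sum charE) /B.
  transitivity (\sum_(m < p) b ^+ (q k ^ m.+1)).
    by apply: eq_bigr => m _; rewrite -exprM -expnSr.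
  rewrite card_towerS; case: (p) p_gt0 => // p' _.
  rewrite big_ord_recr [in RHS]big_ord_recl /= expn0 expr1.
  by rewrite [b + _]addrC addrK.
pose s := - B - c k.
have sp : s ^+ p = s.
  have Bp' : B ^+ p = B - P k ^+ p.-1 by rewrite -Bp addrC subrK.
  have cp' : c k ^+ p = c k + P k ^+ p.-1 by rewrite -tower_eq addrC subrK.
  have := frobD charE 1 (- B) (- c k); have := frobN charE 1; rewrite expn1.
  move=> frobN1; rewrite !frobN1 /s => ->; rewrite Bp' cp' opprB opprD.
  by rewrite [_ - B]addrC [- c k - _]addrC addrA addrK.
have EB : B = - c k - s by rewrite /s opprB addKr opprK.
have Bq2 : B ^+ q k = B - t.
  rewrite EB (frobD charE) !(frobN charE) conj_k frob_fixX // opprD.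
  by rewrite addrAC.
apply/eqP; rewrite -(inj_eq (addrI (B - b))) -Bq Bq2.
by rewrite addrA subrK.
Qed.

Lemma tower_subring k : subring_closed (tower iota c k).
Proof.
elim: k => [|k IHk] /=; last by have [] := adjoin_ring_subring (c k) IHk.
split=> [|_ _ /codomP[x ->] /codomP[y ->]|_ _ /codomP[x ->] /codomP[y ->]].
- by apply/codomP; exists 1; rewrite rmorph1.
- by apply/codomP; exists (x - y); rewrite rmorphB.
- by apply/codomP; exists (x * y); rewrite rmorphM.
Qed.

Lemma mem_tower j k : (j < k)%N -> c j \in tower iota c k.
Proof.
elim: k => // k IHk.
have [_ sub_k mem_k] := adjoin_ring_subring (c k) (tower_subring k).
by rewrite ltnS leq_eqVlt => /orP[/eqP-> | /IHk/sub_k].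
Qed.

(** The q_k-Frobenius is a ring morphism fixing the coefficients, by induction, and the adjoined
    generator, by [tower_conj]. *)
Lemma tower_fixed k x : x \in tower iota c k -> x ^+ q k = x.
Proof.
elim: k x => [|k IHk] x /=.
  move=> /codomP[y ->]; rewrite expn0 expn1 -rmorphXn /=.
  by have := expf_card y; rewrite card_Fp // => ->.
move=> /asboolP[f /allP f_k ->].
rewrite horner_coef (frob_sum charE); apply: eq_bigr => i _.
rewrite exprMn exprAC; congr (_ * _ ^+ _); last by apply: (tower_conj _).1.
by rewrite card_towerS frob_fixX // IHk //; apply/f_k/mem_nth.
Qed.

Lemma tower_divr k : divr_closed (H k).
Proof.
have [H1 _ HM] := tower_subring k.
have HX m x : x \in tower iota c k -> x ^+ m \in tower iota c k.
  by move=> Hx; elim: m => [|m IHm] //; rewrite exprS HM.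
split=> [|x y]; first by rewrite inE oner_eq0 andbT.
rewrite !inE => /andP[Hx x0] /andP[Hy y0].
rewrite mulf_neq0 ?invr_eq0 // andbT HM //.
(* Inverses are powers because y^(q_k) = y, so closure under products suffices. *)
have -> : y^-1 = y ^+ (q k - 2).
  apply: (mulfI y0); apply: (mulfI y0); rewrite mulfV // mulr1 -!exprS.
  rewrite -subSn ?card_tower_gt1 // subSS subn1.
  by rewrite prednK ?tower_fixed // expn_gt0 p_gt0.
exact: HX.
Qed.

Lemma tower_prod_mem k e : P k ^+ e \in H k.
Proof.
have [H1 _ HM] := tower_subring k.
rewrite inE expf_neq0 ?tower_prod_neq0 // andbT; elim: e => // e IHe.
rewrite exprS HM //; apply: (big_ind (fun x => x \in tower iota c k)) => // j _.
exact: mem_tower.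
Qed.

Lemma tower_exp_card k x : x \in H k -> x ^+ (q k - 1) = 1.
Proof.
case/andP => Hx x0; apply: (mulfI x0).
by rewrite -exprS subn1 prednK ?mulr1 ?tower_fixed // expn_gt0 p_gt0.
Qed.

Lemma tower_exp_N k x : x \in tower iota c k -> x ^+ N_ p k = x ^+ p.
Proof.
move=> Hx; rewrite N_sum // expr_sum -[in RHS](card_ord p) -prodr_const.
by apply: eq_bigr => i _; rewrite frob_fixX ?tower_fixed.
Qed.

(** The left side is the product of the conjugates c_k + i t, which is c_k^p - c_k by
    [prod_addFp]. *)
Lemma tower_gen_exp_N k : c k ^+ N_ p k = P k ^+ p.-1.
Proof.
have [_ [t [t0 tp conj_k]]] := tower_conj k.
rewrite N_sum // expr_sum -tower_eq -(prod_addFp charE _ t0 tp).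
by apply: eq_bigr => i _; apply: (frob_shift charE) => //; apply: frob_fixX.
Qed.

Lemma tower_gen_notin k : c k \notin tower iota c k.
Proof.
have [_ [t [t0 _ conj_k]]] := tower_conj k; apply: contra_neqN t0.
move/tower_fixed; rewrite conj_k => /eqP.
by rewrite -subr_eq0 addrC addKr => /eqP.
Qed.

(** A factor from L_{k-1}^* does not change the order modulo L_{k-1}^*; u = 1 gives c_k and u = P_k
    gives P_{k+1}. *)
Lemma dvdn_tower_order k u n : u \in H k ->
  (M_ iota c k %| n)%N = ((c k * u) ^+ n \in H k).
Proof.
move=> Hu; have [H1 Hdiv] := tower_divr k.
have HV v : v \in H k -> v^-1 \in H k by rewrite -[v^-1]mul1r; apply: Hdiv.
have HuX : u ^+ n \in H k.
  elim: n => // n IHn; rewrite exprS -[u ^+ n]invrK.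
  by apply: Hdiv => //; apply: HV.
have u0 : u ^+ n != 0 by case/andP: HuX.
rewrite /M_ dvdn_order_mod ?tower_neq0 //.
rewrite exprMn; apply/idP/idP => [Hc | Hcu].
  by rewrite -[u ^+ n]invrK; apply: Hdiv => //; apply: HV.
by rewrite -(mulfK u0 (c k ^+ n)); apply: Hdiv.
Qed.

(** * Descent of divisibility along the norm identities *)

Lemma prod_N_dvd s k : (s <= k)%N -> (Pi s k %| q k - 1)%N.
Proof. by move=> le_sk; rewrite -(prod_N_mul p_prime le_sk) dvdn_mulr. Qed.

Lemma card_sub1_dvd s k : (s <= k)%N -> (q s - 1 %| q k - 1)%N.
Proof. by move=> le_sk; rewrite -(prod_N_mul p_prime le_sk) dvdn_mull. Qed.

Lemma coprime_prod_N s t k : (t <= s)%N -> coprime (Pi s k) (q t - 1).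
Proof.
move=> le_ts; rewrite big_nat; apply: (big_ind (fun n => coprime n (q t - 1))).
- exact: coprime1n.
- by move=> m n com con; rewrite coprimeMl com.
move=> j /andP[le_sj _]; apply: coprime_dvdr (coprime_N_card p_prime j).
exact: card_sub1_dvd (leq_trans le_ts le_sj).
Qed.

(** The descent step, shared by c_k (u = 1, e = p - 1) and P_{k+1} (u = P_k, e = 2p - 1). *)
Lemma prod_N_dvd_order s k e u :
    (s <= k)%N -> u \in H k -> (c k * u) ^+ N_ p k = P k ^+ e ->
    coprime (Pi s k) e ->
  (Pi s k.+1 %| mul_order (c k * u))%N <->
  (M_ iota c k = N_ p k /\ (Pi s k %| mul_order (P k))%N).
Proof.
move=> le_sk Hu norm_x co_e; set x := c k * u.
have x0 : x != 0 by rewrite mulf_neq0 ?tower_neq0 //; case/andP: Hu.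
have P0 := tower_prod_neq0 k.
have M_dvd : (M_ iota c k %| N_ p k)%N.
  by rewrite (dvdn_tower_order _ Hu) norm_x tower_prod_mem.
have Npos : (0 < N_ p k)%N := N_gt0 p_prime k.
have EPi : (Pi s k.+1 = Pi s k * N_ p k)%N by rewrite big_nat_recr.
have Pi_gt0 : (0 < Pi s k)%N by apply: prodn_gt0 => j; apply: N_gt0.
split=> [dvd_O | [eqMN dvd_O]].
  (* O(x) divides M_k (q_k - 1). Cancelling [Pi s k] leaves N_k dividing M_k (q_s - 1), and N_k is
     prime to q_s - 1. *)
  have N_dvd : (N_ p k %| M_ iota c k)%N.
    have : (mul_order x %| M_ iota c k * (q k - 1))%N.
      rewrite dvdn_mul_order // exprM tower_exp_card //.
      by rewrite -(dvdn_tower_order _ Hu).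
    move/(dvdn_trans dvd_O).
    rewrite EPi -(prod_N_mul p_prime le_sk) mulnCA dvdn_pmul2l // Gauss_dvdl //.
    by apply: coprime_dvdr (coprime_N_card p_prime k); apply: card_sub1_dvd.
  split; first by apply/eqP; rewrite eqn_dvd M_dvd.
  have := dvdn_trans dvd_O (mul_order_dvdX (N_ p k) x0).
  rewrite EPi mulnC dvdn_pmul2l // norm_x => /dvdn_trans; apply.
  exact: mul_orderX_dvd.
have : (N_ p k %| mul_order x)%N.
  rewrite -eqMN (dvdn_tower_order _ Hu).
  have := dvdnn (mul_order x); rewrite dvdn_mul_order // => /eqP->.
  by have [] := tower_divr k.
(* With O(x) = o N_k it remains that [Pi s k] divides o: it divides O(P_k^e), as it is prime to e,
   and P_k^e = x^(N_k) is killed by o. *)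
case/dvdnP=> o Eo; rewrite Eo EPi dvdn_pmul2r //.
apply: dvdn_trans (dvdn_mul_orderX P0 co_e dvd_O) _.
rewrite dvdn_mul_order ?expf_neq0 // -norm_x -exprM mulnC -Eo.
by rewrite -dvdn_mul_order.
Qed.

(** The factor c_k contributes the exponent p - 1, and P_k, fixed by the q_k-Frobenius, contributes
    p. *)
Lemma tower_prod_exp_N k : P k.+1 ^+ N_ p k = P k ^+ (p + p.-1).
Proof.
rewrite big_ord_recr /= exprMn tower_gen_exp_N exprD; congr (_ * _).
by apply: tower_exp_N; have /andP[] := tower_prod_mem k 1.
Qed.

Lemma prod_N_dvd_order_prod s k : (forall l, coprime (Pi s l) (p + p.-1)) ->
    (s <= k)%N ->
  (Pi s k %| mul_order (P k))%N <->
  (forall j, (s <= j < k)%N -> M_ iota c j = N_ p j).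
Proof.
move=> co_s; elim: k => [|k IHk].
  by rewrite leqn0 => /eqP->; rewrite big_geq // dvd1n.
rewrite leq_eqVlt ltnS => /orP[/eqP<- | le_sk].
  rewrite big_geq // dvd1n; split=> // _ j /andP[le_sj].
  by rewrite ltnNge le_sj.
have EP : P k.+1 = c k * P k by rewrite big_ord_recr mulrC.
have norm_P := tower_prod_exp_N k; rewrite EP in norm_P *.
have HP : P k \in H k by have := tower_prod_mem k 1.
rewrite (prod_N_dvd_order le_sk HP norm_P (co_s k)) IHk //.
split=> [[eq_k eq_lt] j /andP[le_sj] | eq_all].
  rewrite ltnS leq_eqVlt => /orP[/eqP-> // | lt_jk].
  by apply: eq_lt; rewrite le_sj.
split=> [|j /andP[le_sj lt_jk]]; first by apply: eq_all; rewrite le_sk /=.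
by apply: eq_all; rewrite le_sj ltnW.
Qed.

Lemma prod_N_dvd_order_gen s k : (forall l, coprime (Pi s l) (p + p.-1)) ->
    (s <= k)%N ->
  (Pi s k.+1 %| mul_order (c k))%N <->
  (forall j, (s <= j <= k)%N -> M_ iota c j = N_ p j).
Proof.
move=> co_s le_sk; have [H1 _] := tower_divr k.
(* Here p - 1 = q_0 - 1. *)
have co_p1 : coprime (Pi s k) p.-1.
  by have := coprime_prod_N k (leq0n s); rewrite expn0 expn1 subn1.
have norm_c := tower_gen_exp_N k; rewrite -[c k]mulr1 in norm_c *.
rewrite (prod_N_dvd_order le_sk H1 norm_c co_p1) prod_N_dvd_order_prod //.
split=> [[eq_k eq_lt] j /andP[le_sj] | eq_all].
  by rewrite leq_eqVlt => /orP[/eqP-> // | lt_jk]; apply: eq_lt; rewrite le_sj.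
split=> [|j /andP[le_sj lt_jk]]; first by apply: eq_all; rewrite le_sk /=.
by apply: eq_all; rewrite le_sj ltnW.
Qed.

Lemma order_gen_dvd_odd k : (mul_order (c k) %| Pi 0 k.+1)%N.
Proof.
rewrite dvdn_mul_order ?tower_neq0 // big_nat_recr //= mulnC exprM.
rewrite tower_gen_exp_N -exprM mulnC.
have := prod_N_mul p_prime (leq0n k).
rewrite expn0 expn1 [(p - 1)%N]subn1 => ->.
by rewrite tower_exp_card //; have := tower_prod_mem k 1.
Qed.

(** For p = 2, c_k^(N_k) = P_k and P_k^(N_{k-1}) = P_{k-1}^3. The exponent 3 = q_1 - 1 = N_0
    supplies the factor missing from a product starting at N_1; k > 1 allows these two descents with
    [Pi 1 k.-1] still covered by [prod_N_mul]. *)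
Lemma order_gen_dvd_even k : p = 2 -> (1 < k)%N ->
  (mul_order (c k) %| Pi 1 k.+1)%N.
Proof.
move=> p2; case: k => // k; rewrite ltnS => k_gt0.
rewrite dvdn_mul_order ?tower_neq0 // big_nat_recr //= mulnC exprM.
have -> : c k.+1 ^+ N_ p k.+1 = P k.+1 by rewrite tower_gen_exp_N p2.
rewrite big_nat_recr //= mulnC exprM tower_prod_exp_N -exprM mulnC.
have -> : (p + p.-1 = q 1 - 1)%N by rewrite p2.
by rewrite prod_N_mul // tower_exp_card //; have := tower_prod_mem k 1.
Qed.

(** M_k divides N_k, and M_k = 1 would put c_k in L_{k-1}. *)
Lemma order_tower_prime k : prime (N_ p k) -> M_ iota c k = N_ p k.
Proof.
have [H1 _] := tower_divr k.
have M_dvd : (M_ iota c k %| N_ p k)%N.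
  by rewrite (dvdn_tower_order _ H1) mulr1 tower_gen_exp_N tower_prod_mem.
case/primeP=> _ /(_ _ M_dvd)/orP[/eqP M1 | /eqP //].
have : (M_ iota c k %| 1)%N by rewrite M1.
by rewrite (dvdn_tower_order _ H1) mulr1 expr1 inE (negPf (tower_gen_notin _)).
Qed.

End Tower.

(** For p = 2 the geometric series has two terms, so N_k is the Fermat number 2^(2^k) + 1. *)
Lemma fermat_prime k : (k < 5)%N -> prime (N_ 2 k).
Proof.
rewrite N_sum // !big_ord_recr big_ord0 /= add0n expn0 expn1.
by case: k => [|[|[|[|[|k]]]]] // _; vm_compute.
Qed.

Theorem corollary4p8 (p : nat) (p_prime : prime p)
    (E : closedFieldType) (iota : {rmorphism 'F_p -> E})
    (E_closure : is_algebraic_closure iota)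
    (c : nat -> E) (c_tower : is_tower_sequence p c) (i : nat) :
  (odd p ->
     (mul_order (c i) = (\prod_(0 <= j < i.+1) N_ p j)%N
      <-> forall j : nat, (j <= i)%N -> M_ iota c j = N_ p j))
  /\
  (p = 2%N -> (5 <= i)%N ->
     (mul_order (c i) = (\prod_(1 <= j < i.+1) N_ p j)%N
      <-> forall j : nat, (5 <= j <= i)%N -> M_ iota c j = N_ p j)).
Proof.
split=> [p_odd | p2 le5i].
  (* The product divides q_l - 1, which is prime to 2p - 1 for odd p. *)
  have co_0 l : coprime (\prod_(0 <= j < l) N_ p j) (p + p.-1).
    apply: coprime_dvdl (coprime_card_2p1 p_prime l p_odd).
    exact: prod_N_dvd.
  rewrite -(prod_N_dvd_order_gen iota p_prime c_tower co_0 (leq0n i)).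
  split=> [-> // | dvd_O]; apply/eqP; rewrite eqn_dvd dvd_O andbT.
  exact: (order_gen_dvd_odd iota).
(* For p = 2, 2p - 1 = 3 equals N_0, so the product has to start at index 1; there 3 = q_1 - 1 is
   prime to every factor. *)
have co_1 l : coprime (\prod_(1 <= j < l) N_ p j) (p + p.-1).
  have -> : (p + p.-1 = p ^ (p ^ 1) - 1)%N by rewrite p2.
  exact: coprime_prod_N.
have le1i : (1 <= i)%N by apply: leq_trans le5i.
transitivity (\prod_(1 <= j < i.+1) N_ p j %| mul_order (c i))%N.
  split=> [-> // | dvd_O]; apply/eqP; rewrite eqn_dvd dvd_O andbT.
  by apply: (order_gen_dvd_even iota) => //; apply: leq_trans le5i.
rewrite (prod_N_dvd_order_gen iota p_prime c_tower co_1 le1i).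
split=> eq_MN j /andP[le_j le_ji].
  by rewrite eq_MN // le_ji (leq_trans _ le_j).
have [lt_j5 | le_5j] := ltnP j 5; last by rewrite eq_MN // le_5j.
by apply: order_tower_prime => //; rewrite p2 fermat_prime.
Qed.
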